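(* Let $d_1,d_2,d_3$ be positive integers with $\gcd(d_1,d_2,d_3)=1$ and $3\le d_1<d_2<d_3\le d_1d_2-d_1-d_2$, such that none of them is a linear combination of the other two with non-negative integer coefficients, and let $S_3=\langle d_1,d_2,d_3\rangle$. Then the rescaled genus $h_2=K_2/g_3^3$ of $S_3$ satisfies $$\frac{1}{18}<h_2<\frac{1}{9}.$$
   Context: $S_3=\langle d_1,d_2,d_3\rangle$ is the numerical semigroup of all linear combinations of $d_1,d_2,d_3$ with non-negative integer coefficients. The set of gaps is $\Delta_3=\mathbb{Z}_{>0}\setminus S_3$, and the Frobenius number $F_3$ is the largest element of $\Delta_3$. Put $G_r=\sum_{s\in\Delta_3}s^r$ for $r\ge 0$, $\sigma_k=d_1^k+d_2^k+d_3^k$, $\delta_k=(\sigma_k-1)/2^k$, $g_3=F_3+\sigma_1$, and $$K_2=G_2+\sigma_1G_1+\frac{3\sigma_1^2+\sigma_2}{12}G_0+\frac{\delta_1(\delta_1^2+\delta_2)}{3}.$$ *)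

(* Defs.v *)
From mathcomp Require Import all_boot all_order all_algebra.
From mathcomp Require Import boolp classical_sets cardinality fsbigop.

Set Implicit Arguments.
Unset Strict Implicit.
Unset Printing Implicit Defensive.

Import Order.TTheory GRing.Theory Num.Theory.

Local Open Scope classical_set_scope.
Local Open Scope ring_scope.

Definition semigroup2 (a b : nat) : set nat :=
  [set s | exists x y : nat, s = (x * a + y * b)%N].

Definition semigroup3 (d1 d2 d3 : nat) : set nat :=
  [set s | exists x y z : nat, s = (x * d1 + y * d2 + z * d3)%N].

Definition gaps (d1 d2 d3 : nat) : set nat :=
  [set s | (0 < s)%N /\ ~ semigroup3 d1 d2 d3 s].

(* The default value 0 is only taken when the set of gaps has no largest
   element, i.e. is empty or infinite. *)
Definition frobenius (d1 d2 d3 : nat) : nat :=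
  xget 0%N [set m | gaps d1 d2 d3 m /\
                    forall s, gaps d1 d2 d3 s -> (s <= m)%N].

(* Finitely supported sum; gaps d1 d2 d3 is finite when gcd(d1,d2,d3) = 1. *)
Definition gap_sum (d1 d2 d3 r : nat) : rat :=
  \sum_(s \in gaps d1 d2 d3) (s%:R : rat) ^+ r.

Definition sigma (d1 d2 d3 k : nat) : rat :=
  d1%:R ^+ k + d2%:R ^+ k + d3%:R ^+ k.

Definition delta (d1 d2 d3 k : nat) : rat :=
  (sigma d1 d2 d3 k - 1) / 2 ^+ k.

Definition g3 (d1 d2 d3 : nat) : rat :=
  (frobenius d1 d2 d3)%:R + sigma d1 d2 d3 1.

Definition K2 (d1 d2 d3 : nat) : rat :=
  let G := gap_sum d1 d2 d3 in
  let sg := sigma d1 d2 d3 in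
  let dl := delta d1 d2 d3 in
  G 2 + sg 1 * G 1 + (3 * sg 1 ^+ 2 + sg 2) / 12 * G 0
    + dl 1 * (dl 1 ^+ 2 + dl 2) / 3.

Definition h2 (d1 d2 d3 : nat) : rat :=
  K2 d1 d2 d3 / g3 d1 d2 d3 ^+ 3.

(* Main.v *)
Require Import Defs.
From mathcomp Require Import all_boot all_order all_algebra.
From mathcomp Require Import boolp classical_sets fsbigop.
From mathcomp Require Import zify ring lra.

Set Implicit Arguments.
Unset Strict Implicit.
Unset Printing Implicit Defensive.

Import Order.TTheory GRing.Theory Num.Theory.

(** Write a, b, c for d1, d2, d3.  Each residue class modulo a has a least
    element in the semigroup, of the form x b + y c; fixing one pair (x, y) for
    each class gives a finite set L of a lattice points, and L is an L-shaped
    staircase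
      x < A, y < B, and x < C or y < E      (lemma apery_shape),
    possibly reduced to a rectangle.  This is the combinatorial content of
    Herzog's description of three-generated semigroups.

    For a function f put D f(n) = f(n) - f(n+b) - f(n+c) + f(n+b+c).  The sum
    of D f(s) - D f(s+a) over the gaps s telescopes in each residue class, and
    becomes a sum of D f over 0 .. a-1 minus a sum of D f over L.  The latter
    telescopes again, in both directions, to the values of f at the corners of
    the staircase (sum_gaps_staircase).  With X = C b, Y = E c, P = A b,
    Q = B c, taking f(n) = n^2 gives
      V := a b c = P Y + X Q - X Y,
    and taking f(n) = n^5 gives, because K2 is built to match the third
    difference of n^5,
      60 V K2 = M := (X+Q)^5 + (P+Y)^5 - P^5 - Q^5 - (X+Y)^5
    (K2_staircase).  Moreover g3 is the larger of X + Q and P + Y, the values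
    at the two outer corners (g3_staircase).

    The theorem is thus the inequality 10 V g^3 < 3 M < 20 V g^3.  Since V is
    the area of the staircase in the coordinates p = x b, q = y c, and M is
    20 times the integral of (p+q)^3 over it, this says that the mean of
    ((p+q)/g)^3 lies strictly between 1/6 and 1/3.  For a long thin arm
    attached to a short wide one this mean would be arbitrarily small;
    minimality of L prevents that through P - X <= Q and Q - Y <= P.  Once these
    constraints are solved by nonnegative parameters, 3 M - 10 V g^3 and
    20 V g^3 - 3 M become polynomials with nonnegative coefficients
    (corner_bounds_le). *)

(** * The staircase of least representatives *)

(** Comparison of (x, y) with (x', y') by the value x b + y c, ties being broken
    by y.  Like the value itself, this order is invariant under translation;
    the tie-break makes the minimal pair of each residue class unique. *)
Definition lex_le (b c x y x' y' : nat) : bool :=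
  (x * b + y * c < x' * b + y' * c)
  || (x * b + y * c == x' * b + y' * c) && (y <= y').

(** The values x b + y c at these pairs form the Apery set of the semigroup
    with respect to a. *)
Definition apery (a b c x y : nat) : bool :=
  `[< forall x' y', x' * b + y' * c = x * b + y * c %[mod a] ->
      lex_le b c x y x' y' >].

Lemma apery_inj a b c x y x' y' : 0 < b ->
    apery a b c x y -> apery a b c x' y' ->
  x * b + y * c = x' * b + y' * c %[mod a] -> x = x' /\ y = y'.
Proof.
move=> b_gt0 /asboolP Lxy /asboolP Lxy' eq_mod.
have := Lxy _ _ (esym eq_mod); have := Lxy' _ _ eq_mod; rewrite /lex_le.
have [lt1|lt2|e] := ltngtP (x * b + y * c) (x' * b + y' * c) => //= le1 le2.
have ey : y = y' by lia.
split=> //; move: e; rewrite ey => /eqP.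
by rewrite eqn_add2r eqn_pmul2r // => /eqP.
Qed.

(** Translating a competitor of (x', y') by (x - x', y - y') gives a competitor
    of (x, y), so the set of minimal pairs is closed downwards. *)
Lemma apery_le a b c x y x' y' :
  x' <= x -> y' <= y -> apery a b c x y -> apery a b c x' y'.
Proof.
move=> /subnK <- /subnK <-; move: (x - x') (y - y') => u v /asboolP Lxy.
apply/asboolP => s t eq_mod.
have /Lxy : (u + s) * b + (v + t) * c
    = (u + x') * b + (v + y') * c %[mod a].
  have split_comb p q : (u + p) * b + (v + q) * c
      = (u * b + v * c) + (p * b + q * c) by lia.
  by apply/eqP; rewrite !split_comb eqn_modDl; apply/eqP.
by rewrite /lex_le; lia.
Qed.

(** Two Bezout relations, u b = v c + gcd(b, c) and s gcd(b, c) = t a + 1, give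
    the combination; -v is replaced by v (a - 1) to stay in the naturals. *)
Lemma comb_surj_mod a b c n : 0 < a -> 0 < b -> gcdn (gcdn a b) c = 1 ->
  exists x y, x * b + y * c = n %[mod a].
Proof.
move=> a_gt0 b_gt0; rewrite -gcdnA gcdnC => gcd1.
have g_gt0 : 0 < gcdn b c by rewrite gcdn_gt0 b_gt0.
case: (egcdnP c b_gt0) => u v uv _.
case: (egcdnP a g_gt0); rewrite gcd1 => s t st _.
exists (n * s * u), (n * s * v * a.-1).
have -> : n * s * u * b + n * s * v * a.-1 * c
    = (n * t + n * s * v * c) * a + n.
  case: a a_gt0 {gcd1} st => // a _ st /=.
  rewrite -mulnA uv; nia.
by rewrite modnMDl.
Qed.

Lemma apery_ex a b c n : 0 < a -> 0 < b -> gcdn (gcdn a b) c = 1 ->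
  exists x y, apery a b c x y /\ x * b + y * c = n %[mod a].
Proof.
move=> a_gt0 b_gt0 gcd1.
pose P m := `[< exists x y, x * b + y * c = m /\ m = n %[mod a] >].
have exP : exists m, P m.
  have [x [y xy]] := comb_surj_mod n a_gt0 b_gt0 gcd1.
  by exists (x * b + y * c); apply/asboolP; exists x, y.
case: (ex_minnP exP) => m Pm min_m.
pose Q y := `[< exists x, x * b + y * c = m >].
have exQ : exists y, Q y.
  by move/asboolP: Pm => [x [y [xy _]]]; exists y; apply/asboolP; exists x.
case: (ex_minnP exQ) => y /asboolP [x xy] min_y.
move/asboolP: (Pm) => [_ [_ [_ mn]]].
exists x, y; rewrite xy; split=> //; apply/asboolP => s t; rewrite xy => st.
have := min_m (s * b + t * c); rewrite /lex_le xy => /(_ _)/wrap[].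
  by apply/asboolP; exists s, t; rewrite st.
rewrite leq_eqVlt => /orP[/eqP e|->] //; rewrite e eqxx /= ltnn /=.
by apply: min_y; apply/asboolP; exists s.
Qed.

Lemma apery00 a b c : apery a b c 0 0.
Proof. by apply/asboolP => x y _; rewrite /lex_le; lia. Qed.

(** If the representative (x, y) of the pair (s+1, t) just outside L had x > 0,
    then (x-1, y) and (s, t) would be two points of L in one class, hence equal,
    and (s+1, t) = (x, y) would lie in L. *)
Lemma apery_outer_l a b c s t x y : 0 < b ->
    apery a b c s t -> ~~ apery a b c s.+1 t -> apery a b c x y ->
  x * b + y * c = s.+1 * b + t * c %[mod a] -> x = 0.
Proof.
move=> b_gt0 Lst NLst; case: x => // x Lxy eq_mod.
have [|ex ey] := apery_inj b_gt0 (apery_le (leqnSn x) (leqnn y) Lxy) Lst.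
  apply/eqP; rewrite -(eqn_modDl b) !addnA -!mulSn; exact/eqP.
by move: Lxy; rewrite ex ey (negbTE NLst).
Qed.

Lemma apery_outer_r a b c s t x y : 0 < b ->
    apery a b c s t -> ~~ apery a b c s t.+1 -> apery a b c x y ->
  x * b + y * c = s * b + t.+1 * c %[mod a] -> y = 0.
Proof.
move=> b_gt0 Lst NLst; case: y => // y Lxy eq_mod.
have [|ex ey] := apery_inj b_gt0 (apery_le (leqnn x) (leqnSn y) Lxy) Lst.
  by apply/eqP; rewrite -(eqn_modDl c) !(addnCA c) -!mulSn; apply/eqP.
by move: Lxy; rewrite ex ey (negbTE NLst).
Qed.

(** At a concave corner both coordinates of the representative vanish. *)
Lemma apery_corner a b c s t :
    0 < a -> 0 < b -> gcdn (gcdn a b) c = 1 ->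
    apery a b c s t.+1 -> apery a b c s.+1 t -> ~~ apery a b c s.+1 t.+1 ->
  a %| s.+1 * b + t.+1 * c.
Proof.
move=> a_gt0 b_gt0 gcd1 Ls Lt NL.
have [x [y [Lxy eq_mod]]] := apery_ex (s.+1 * b + t.+1 * c) a_gt0 b_gt0 gcd1.
have x0 := apery_outer_l b_gt0 Ls NL Lxy eq_mod.
have y0 := apery_outer_r b_gt0 Lt NL Lxy eq_mod.
by rewrite /dvdn -eq_mod x0 y0 mod0n.
Qed.

(** Subtracting two concave corners gives the congruence (s'-s) b = (t-t') c
    between two distinct points on the axes of L; hence L has at most one. *)
Lemma apery_corner_cross a b c s t s' t' : 0 < b ->
    apery a b c (s' - s) 0 -> apery a b c 0 (t - t') -> s < s' -> t' <= t ->
    a %| s * b + t * c -> a %| s' * b + t' * c -> False.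
Proof.
move=> b_gt0 Ls Lt lt_s le_t st st'.
have [|e _] := apery_inj b_gt0 Ls Lt; last by lia.
apply/eqP; rewrite -(eqn_modDl (s * b + t' * c)).
have -> : s * b + t' * c + ((s' - s) * b + 0 * c) = s' * b + t' * c.
  by rewrite -{2}(subnKC (ltnW lt_s)); lia.
have -> : s * b + t' * c + (0 * b + (t - t') * c) = s * b + t * c.
  by rewrite -{2}(subnKC le_t); lia.
by apply/eqP; rewrite (eqP st) (eqP st').
Qed.

(** The corner is obtained from the first point outside L of the row t, by
    taking the lowest point outside L of its column. *)
Lemma apery_ex_corner a b c s t u :
    apery a b c s t -> ~~ apery a b c u t -> apery a b c u 0 ->
  exists x y, [/\ s <= x < u, y < t, apery a b c x y.+1,
     apery a b c x.+1 y & ~~ apery a b c x.+1 y.+1].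
Proof.
move=> Lst NLut Lu0.
have exs : exists x, ~~ apery a b c x t by exists u.
case: (ex_minnP exs) => x NLxt min_x.
have s_lt_x : s < x.
  by rewrite ltnNge; apply: contra NLxt => le_xs; exact: apery_le Lst.
have x_le_u := min_x u NLut.
have exty : exists y, ~~ apery a b c x y by exists t.
case: (ex_minnP exty) => y NLxy min_y.
have y_gt0 : 0 < y.
  rewrite lt0n; apply: contra NLxy => /eqP->; exact: apery_le Lu0.
have y_le_t := min_y t NLxt.
case: x => [|x] in s_lt_x NLxt min_x x_le_u exty NLxy min_y *; first by [].
case: y => [|y] in NLxy min_y y_gt0 y_le_t *; first by [].
exists x, y; split=> //; first by rewrite -ltnS s_lt_x.
  have Lxt : apery a b c x t by apply: contraT => /min_x; rewrite ltnn.
  exact: apery_le Lxt.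
by apply: contraT => /min_y; rewrite ltnn.
Qed.

(** A and B bound L on the axes.  If the far point of that box is missing, there
    is a concave corner (C, E); a second corner would contradict
    apery_corner_cross, so nothing else is cut out.  The rectangle is encoded as
    C = A, E = B.

    For (B - E) c <= A b, the point (A, 0) is congruent to some (0, y) of L with
    y c <= A b.  As (C, E) is congruent to 0, (A - C, 0) is congruent to
    (0, y + E), and y < B - E would put both in L.  The other inequality is the
    mirror image. *)
Lemma apery_shape a b c :
    0 < a -> 0 < b -> 0 < c -> gcdn (gcdn a b) c = 1 ->
  exists A B C E,
    [/\ 0 < C <= A, 0 < E <= B, (A - C) * b <= B * c, (B - E) * c <= A * b
      & forall x y, apery a b c x y
                    = [&& x < A, y < B & (x < C) || (y < E)]].
Proof.
move=> a_gt0 b_gt0 c_gt0 gcd1.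
have L00 := apery00 a b c.
have exA : exists x, ~~ apery a b c x 0.
  exists a; apply/negP => La.
  by have [|e _] := apery_inj b_gt0 La L00;
    rewrite ?mul0n ?addn0 ?modnMr ?modnMl ?mod0n; lia.
have exB : exists y, ~~ apery a b c 0 y.
  exists a; apply/negP => La.
  by have [|_ e] := apery_inj b_gt0 La L00;
    rewrite ?mul0n ?add0n ?modnMr ?modnMl ?mod0n; lia.
case: (ex_minnP exA) => -[|A] NLA min_A; first by rewrite L00 in NLA.
case: (ex_minnP exB) => -[|B] NLB min_B; first by rewrite L00 in NLB.
have LA x : apery a b c x 0 = (x <= A).
  apply/idP/idP => [Lx|le_x].
    by rewrite leqNgt; apply: contra NLA => lt_A; exact: apery_le Lx.
  by apply: contraT => /min_A; lia.
have LB y : apery a b c 0 y = (y <= B).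
  apply/idP/idP => [Lx|le_x].
    by rewrite leqNgt; apply: contra NLB => lt_B; exact: apery_le Lx.
  by apply: contraT => /min_B; lia.
have in_box x y : apery a b c x y -> x <= A /\ y <= B.
  by move=> Lxy; rewrite -LA -LB; split; apply: apery_le Lxy.
have [LAB|NLAB] := boolP (apery a b c A B).
  exists A.+1, B.+1, A.+1, B.+1; split; rewrite ?subnn ?leqnn //.
  move=> x y; apply/idP/idP => [/in_box[]|/and3P[? ? _]]; first by lia.
  by apply: apery_le LAB; lia.
have L0B : apery a b c 0 B by rewrite LB.
have LA0 : apery a b c A 0 by rewrite LA.
have [C [E [C_lt E_lt LCE1 LC1E NLCE]]] := apery_ex_corner L0B NLAB LA0.
(* The arm x <= C is full: another concave corner would lie to the left. *)
have LCB : apery a b c C B.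
  apply: contraT => NLCB.
  have LC0 : apery a b c C 0 by rewrite LA ltnW.
  have [x [y [x_lt y_lt Lx Ly NLxy]]] := apery_ex_corner L0B NLCB LC0.
  case: (leqP y E) => [le_y|lt_y].
    by rewrite (apery_le _ _ LCE1) // in NLxy.
  case: (@apery_corner_cross a b c x.+1 y.+1 C.+1 E.+1) => //.
  - by rewrite LA; move: C_lt x_lt; clear; lia.
  - by rewrite LB; move: y_lt E_lt; clear; lia.
  - exact: ltnW.
  - exact: apery_corner Lx Ly NLxy.
  - exact: apery_corner LCE1 LC1E NLCE.
(* The arm y <= E is full: another concave corner would lie to the right. *)
have LAE : apery a b c A E.
  apply: contraT => NLAE.
  have [x [y [x_lt y_lt Lx Ly NLxy]]] := apery_ex_corner LC1E NLAE LA0.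
  case: (@apery_corner_cross a b c C.+1 E.+1 x.+1 y.+1) => //.
  - by rewrite LA; move: C_lt x_lt; clear; lia.
  - by rewrite LB; move: y_lt E_lt; clear; lia.
  - by move: x_lt; clear; lia.
  - by move: y_lt; clear; lia.
  - exact: apery_corner LCE1 LC1E NLCE.
  - exact: apery_corner Lx Ly NLxy.
have dvd_CE := apery_corner a_gt0 b_gt0 gcd1 LCE1 LC1E NLCE.
have [A_gtC B_gtE] : C < A /\ E < B by split.
exists A.+1, B.+1, C.+1, E.+1; split; rewrite ?subSS.
- exact: (ltnW A_gtC).
- exact: (ltnW B_gtE).
- have [x [y [Lxy eq_mod]]] := apery_ex (0 * b + B.+1 * c) a_gt0 b_gt0 gcd1.
  have y0 := apery_outer_r b_gt0 L0B NLB Lxy eq_mod.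
  have le_v : x * b <= B.+1 * c.
    by move/asboolP: Lxy => /(_ _ _ (esym eq_mod)); rewrite /lex_le y0;
    clear; lia.
  apply: leq_trans le_v; rewrite leq_mul2r; apply/orP; right.
  rewrite leqNgt; apply/negP => lt_x.
  have [|||e _] := @apery_inj a b c (x + C.+1) 0 0 (B - E) b_gt0.
  + by rewrite LA; move: lt_x; clear; lia.
  + by rewrite LB; move: lt_x; clear; lia.
  apply/eqP; rewrite -(eqn_modDl (E.+1 * c)).
  have -> : E.+1 * c + ((x + C.+1) * b + 0 * c)
     = (x * b + 0 * c) + (C.+1 * b + E.+1 * c) by clear; lia.
  have -> : E.+1 * c + (0 * b + (B - E) * c) = 0 * b + B.+1 * c.
    by rewrite -{2}(subnKC (ltnW E_lt)); clear; lia.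
  + by rewrite -modnDmr (eqP dvd_CE) addn0; apply/eqP; rewrite -eq_mod y0.
  by rewrite addnS in e.
- have [x [y [Lxy eq_mod]]] := apery_ex (A.+1 * b + 0 * c) a_gt0 b_gt0 gcd1.
  have x0 := apery_outer_l b_gt0 LA0 NLA Lxy eq_mod.
  have le_v : y * c <= A.+1 * b.
    by move/asboolP: Lxy => /(_ _ _ (esym eq_mod)); rewrite /lex_le x0;
    clear; lia.
  apply: leq_trans le_v; rewrite leq_mul2r; apply/orP; right.
  rewrite leqNgt; apply/negP => lt_y.
  have [|||e _] := @apery_inj a b c (A - C) 0 0 (y + E.+1) b_gt0.
  + by rewrite LA; move: lt_y B_gtE; clear; lia.
  + by rewrite LB; move: lt_y B_gtE; clear; lia.
  apply/esym/eqP; rewrite -(eqn_modDl (C.+1 * b)).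
  have -> : C.+1 * b + (0 * b + (y + E.+1) * c)
     = (0 * b + y * c) + (C.+1 * b + E.+1 * c) by clear; lia.
  have -> : C.+1 * b + ((A - C) * b + 0 * c) = A.+1 * b + 0 * c.
    by rewrite -{2}(subnKC (ltnW A_gtC)); clear; lia.
  + by rewrite -modnDmr (eqP dvd_CE) addn0; apply/eqP; rewrite -eq_mod x0.
  by move: e A_gtC; clear; lia.
- move=> x y; apply/idP/idP => [Lxy|].
    have [] := in_box x y Lxy.
    suff: ~~ ((C < x) && (E < y)) by clear; lia.
    by apply: contra NLCE => /andP[Cx Ey]; apply: apery_le Lxy.
  case/and3P => xA yB /orP[xC|yE]; first by apply: apery_le LCB.
  by apply: apery_le LAE.
Qed.

(** * Gaps and the Frobenius number *)

Lemma gaps_apery a b c x y s : 0 < a ->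
    apery a b c x y -> x * b + y * c = s %[mod a] ->
  gaps a b c s <-> s < x * b + y * c.
Proof.
move=> a_gt0 /asboolP Lxy eq_mod; split=> [[s_gt0 notS]|lt_s].
  rewrite ltnNge; apply/negP => le_s; apply: notS.
  have : a %| s - (x * b + y * c) by rewrite -eqn_mod_dvd // eq_sym; apply/eqP.
  case/dvdnP => k def_s; exists k, x, y.
  by rewrite -addnA -def_s subnK.
have notS : ~ semigroup3 a b c s.
  case=> k [x' [y' def_s]]; move: eq_mod.
  rewrite def_s -addnA modnMDl => /esym/Lxy; rewrite /lex_le.
  by move: lt_s; rewrite def_s; clear; lia.
split=> //; rewrite lt0n; apply/eqP => s0; apply: notS.
by exists 0, 0, 0; rewrite s0.
Qed.

Lemma apery_root a b c :
    0 < a -> 0 < b -> gcdn (gcdn a b) c = 1 ->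
  exists p : nat -> nat * nat, forall n,
    apery a b c (p n).1 (p n).2 /\ (p n).1 * b + (p n).2 * c = n %[mod a].
Proof.
move=> a_gt0 b_gt0 gcd1.
have rep n : exists u : nat * nat,
    apery a b c u.1 u.2 /\ u.1 * b + u.2 * c = n %[mod a].
  by have [x [y xy]] := apery_ex n a_gt0 b_gt0 gcd1; exists (x, y).
by have [p pP] := boolp.choice rep; exists p.
Qed.

(** The largest gap of each class lies a below its least element.  The
    generators exceed 1, so 1 is a gap and the subtraction is not truncated. *)
Lemma frobenius_apery a b c x y :
    1 < a -> 1 < b -> 1 < c -> gcdn (gcdn a b) c = 1 ->
    apery a b c x y ->
    (forall x' y', apery a b c x' y' -> x' * b + y' * c <= x * b + y * c) ->
  frobenius a b c + a = x * b + y * c.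
Proof.
move=> a_gt1 b_gt1 c_gt1 gcd1 Lxy max_xy.
have a_gt0 := ltnW a_gt1; have b_gt0 := ltnW b_gt1.
set M := x * b + y * c in max_xy *.
have gap_le s : gaps a b c s -> s + a <= M.
  have [x' [y' [Lxy' eq_mod]]] := apery_ex s a_gt0 b_gt0 gcd1.
  move/(gaps_apery a_gt0 Lxy' eq_mod) => lt_s.
  apply: leq_trans (max_xy _ _ Lxy'); move: lt_s eq_mod; clear -a_gt0.
  set n := x' * b + y' * c => lt_s eq_mod.
  have : a %| n - s by rewrite -eqn_mod_dvd ?(ltnW lt_s) //; apply/eqP.
  move/dvdn_leq; rewrite subn_gt0 => /(_ lt_s).
  by move: lt_s; clear; lia.
have gap1 : gaps a b c 1.
  split=> // -[k [u [v]]]; move: a_gt1 b_gt1 c_gt1.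
  by case: k u v => [|k] [|u] [|v]; rewrite ?mulSn; clear; lia.
have a_le_M : a <= M by apply: leq_trans (gap_le 1 gap1); rewrite leq_addl.
suff -> : frobenius a b c = M - a by rewrite subnK.
have gapM : gaps a b c (M - a).
  apply/(gaps_apery a_gt0 Lxy); last by rewrite -/M; lia.
  by rewrite -/M -{1}(subnK a_le_M) modnDr.
apply: xget_unique.
  by split=> // s /gap_le; clear; lia.
move=> z [/gap_le z_le /(_ _ gapM) z_ge].
by move: z_le z_ge a_le_M; clear; lia.
Qed.

Lemma gaps_bounded a b c : 0 < a -> 0 < b -> gcdn (gcdn a b) c = 1 ->
  exists N, forall s, gaps a b c s -> s < N.
Proof.
move=> a_gt0 b_gt0 gcd1; have [p pP] := apery_root a_gt0 b_gt0 gcd1.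
exists (\sum_(i < a) ((p i).1 * b + (p i).2 * c)) => s gap_s.
have s_lt : s %% a < a by rewrite ltn_pmod.
have [Lp eq_mod] := pP (s %% a).
rewrite (bigD1 (Ordinal s_lt)) //=.
apply: leq_trans (leq_addr _ _); apply/(gaps_apery a_gt0 Lp) => //.
by rewrite eq_mod modn_mod.
Qed.

(** * Telescoping *)

Local Open Scope ring_scope.

Lemma sum_gaps_nat a b c N (g : nat -> rat) :
    (forall s, gaps a b c s -> (s < N)%N) ->
  \sum_(s \in gaps a b c) g s = \sum_(0 <= s < N | `[< gaps a b c s >]) g s.
Proof.
move=> gap_lt; rewrite -[RHS]big_filter.
rewrite [RHS]fsbig_seq ?filter_uniq ?iota_uniq //.
apply: eq_fsbigl; apply/seteqP; split=> s /=.
  move=> gap_s; rewrite mem_filter mem_index_iota gap_lt //=.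
  by rewrite andbT; apply/asboolP.
by rewrite mem_filter => /andP[/asboolP].
Qed.

(** The gaps in the class of i < a are i, i + a, ..., w - a with w the least
    element of the semigroup in the class. *)
Lemma sum_gaps_telescope a b c (g : nat -> rat) p :
    (0 < a)%N -> (0 < b)%N -> gcdn (gcdn a b) c = 1%N ->
    (forall n, apery a b c (p n).1 (p n).2
               /\ (p n).1 * b + (p n).2 * c = n %[mod a])%N ->
  \sum_(s \in gaps a b c) (g s - g (s + a)%N)
    = \sum_(0 <= i < a) (g i - g ((p i).1 * b + (p i).2 * c)%N).
Proof.
move=> a_gt0 b_gt0 gcd1 pP.
have [N gap_lt] := gaps_bounded a_gt0 b_gt0 gcd1.
rewrite (@sum_gaps_nat _ _ _ (N * a)); last first.
  by move=> s /gap_lt lt_s; apply: leq_trans lt_s _; rewrite leq_pmulr.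
rewrite big_mkcond /= big_nat_mul.
under eq_big_nat => k _.
  rewrite -[(k * a)%N]add0n big_addn mulSn addnK.
  over.
rewrite exchange_big_nat /=; apply: eq_big_nat => i /andP[_ i_lt].
have [Lp eq_mod] := pP i.
set w := ((p i).1 * b + (p i).2 * c)%N in eq_mod *.
have def_w : w = (i + (w %/ a) * a)%N.
  by rewrite {1}(divn_eq w a) eq_mod modn_small // addnC.
set m := (w %/ a)%N in def_w.
have gapE k : `[< gaps a b c (i + k * a)%N >] = (k < m)%N.
  have eq_modk : (w = i + k * a %[mod a])%N by rewrite addnC modnMDl.
  have := gaps_apery a_gt0 Lp eq_modk.
  rewrite -/w def_w ltn_add2l ltn_pmul2r // => gapP.
  by apply/asboolP/idP => /gapP.
have le_m : (m <= N)%N.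
  case: (m) gapE => // m' gapE; have : (m' < m'.+1)%N by [].
  rewrite -gapE => /asboolP/gap_lt; apply: leq_trans.
  by rewrite ltnS (leq_trans _ (leq_addl _ _)) // leq_pmulr.
rewrite (big_cat_nat (leq0n m) le_m) /= [X in _ + X]big1_seq; last first.
  move=> k /andP[_]; rewrite mem_index_iota => /andP[le_k _].
  by rewrite gapE ltnNge le_k.
rewrite addr0 (@telescope_sumr_eq _ _ _ (fun k => - g (i + k * a)%N)) //.
  by rewrite -def_w mul0n addn0 opprK addrC.
move=> k /andP[_ lt_k]; rewrite gapE lt_k opprK addrC mulSn.
by rewrite (addnC a) addnA.
Qed.

Lemma sum_rectangle (F : nat -> nat -> rat) x0 x1 y1 : (x0 <= x1)%N ->
  \sum_(x0 <= x < x1) \sum_(0 <= y < y1)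
     (F x y - F x.+1 y - F x y.+1 + F x.+1 y.+1)
  = F x0 0%N - F x1 0%N - F x0 y1 + F x1 y1.
Proof.
move=> le_x.
rewrite (@telescope_sumr_eq _ _ _ (fun x => F x y1 - F x 0%N)) //;
  first by ring.
move=> x _.
rewrite (@telescope_sumr_eq _ _ _ (fun y => F x.+1 y - F x y)) //;
  first by ring.
by move=> y _; ring.
Qed.

(** The staircase is the rectangle x < C, y < B followed by C <= x < A, y < E;
    the terms at the point (C, 0) cancel. *)
Lemma sum_staircase (F : nat -> nat -> rat) A B C E :
    (C <= A)%N -> (E <= B)%N ->
  \sum_(0 <= x < A) \sum_(0 <= y < B | (x < C)%N || (y < E)%N)
     (F x y - F x.+1 y - F x y.+1 + F x.+1 y.+1)
  = F 0%N 0%N - F A 0%N - F 0%N B - F C E + F C B + F A E.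
Proof.
move=> le_C le_E; rewrite (big_cat_nat (leq0n C) le_C) /=.
under eq_big_nat => x /andP[_ ->] do [].
rewrite sum_rectangle //.
under [X in _ + X]eq_big_nat => x /andP[le_x _].
  rewrite ltnNge le_x /= -(big_nat_widen 0 E B xpredT) //.
  over.
by rewrite sum_rectangle //; ring.
Qed.

(** Reduction modulo a is a bijection from L to the residues. *)
Lemma sum_apery a b c A B C E p (g : nat -> rat) :
    (0 < a)%N -> (0 < b)%N ->
    (forall x y, apery a b c x y
       = [&& (x < A)%N, (y < B)%N & (x < C)%N || (y < E)%N]) ->
    (forall n, apery a b c (p n).1 (p n).2
               /\ (p n).1 * b + (p n).2 * c = n %[mod a])%N ->
  \sum_(0 <= i < a) g ((p i).1 * b + (p i).2 * c)%N
  = \sum_(0 <= x < A) \sum_(0 <= y < B | (x < C)%N || (y < E)%N)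
      g (x * b + y * c)%N.
Proof.
move=> a_gt0 b_gt0 LE pP; rewrite !big_mkord.
under [RHS]eq_bigr => x _ do rewrite big_mkord.
rewrite pair_big_dep /=.
have res_lt (u : 'I_A * 'I_B) : ((u.1 * b + u.2 * c) %% a < a)%N.
  by rewrite ltn_pmod.
rewrite [RHS](partition_big (fun u => Ordinal (res_lt u)) xpredT) //=.
apply: eq_bigr => i _; have [Lp eq_mod] := pP i.
move: (Lp); rewrite LE => /and3P[x_lt y_lt in_L].
rewrite (big_pred1 (Ordinal x_lt, Ordinal y_lt)) //= => -[x y] /=.
apply/andP/eqP => [[Lxy /eqP/(congr1 val) /= res_xy]|[-> ->]] /=; last first.
  split=> //; apply/eqP/val_inj => /=.
  by rewrite eq_mod modn_small.
have [|||ex ey] := @apery_inj a b c x y (p i).1 (p i).2 b_gt0.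
- by rewrite LE !ltn_ord.
- exact: Lp.
- by rewrite eq_mod res_xy modn_small.
- by congr pair; apply: val_inj.
Qed.

Lemma sum_gaps_staircase a b c A B C E (f : nat -> rat)
    (D := fun n : nat => f n - f (n + b)%N - f (n + c)%N + f (n + b + c)%N) :
    (0 < a)%N -> (0 < b)%N -> gcdn (gcdn a b) c = 1%N ->
    (C <= A)%N -> (E <= B)%N ->
    (forall x y, apery a b c x y
       = [&& (x < A)%N, (y < B)%N & (x < C)%N || (y < E)%N]) ->
  \sum_(s \in gaps a b c) (D s - D (s + a)%N)
  = \sum_(0 <= i < a) D i
    - (f 0%N - f (A * b)%N - f (B * c)%N - f (C * b + E * c)%N
       + f (C * b + B * c)%N + f (A * b + E * c)%N).
Proof.
move=> a_gt0 b_gt0 gcd1 le_C le_E LE.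
have [p pP] := apery_root a_gt0 b_gt0 gcd1.
rewrite (sum_gaps_telescope D a_gt0 b_gt0 gcd1 pP) sumrB.
rewrite (sum_apery D a_gt0 b_gt0 LE pP); congr (_ - _).
pose F x y := f (x * b + y * c)%N.
transitivity (\sum_(0 <= x < A) \sum_(0 <= y < B | (x < C)%N || (y < E)%N)
     (F x y - F x.+1 y - F x y.+1 + F x.+1 y.+1)).
  apply: eq_bigr => x _; apply: eq_bigr => y _; rewrite /D /F.
  by congr (_ - f _ - f _ + f _); lia.
rewrite sum_staircase // /F !mul0n !addn0 !add0n.
by ring.
Qed.

(** * The corner formula for K2 *)

(** This is where the last term of K2, expressed by delta, comes from. *)
Lemma sum_quintic (n b c : nat) (f := fun i : nat => (i%:R : rat) ^+ 5)
    (D := fun i : nat => f i - f (i + b)%N - f (i + c)%N + f (i + b + c)%N) :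
  \sum_(0 <= i < n) D i
  = 60 * n%:R * b%:R * c%:R
    * (delta n b c 1 * (delta n b c 1 ^+ 2 + delta n b c 2) / 3).
Proof.
rewrite /delta /sigma /D /f; elim: n => [|n IHn].
  by rewrite big_nil; field.
rewrite big_nat_recr //= IHn !natrD -[n.+1%:R]natr1.
move: (n%:R) (b%:R) (c%:R) => u v w; by field.
Qed.

(** The third difference of n^2 vanishes, so the quadratic case only compares
    constants.  For n^5 the third difference at s is
      -60 a b c (s^2 + sigma_1 s + (3 sigma_1^2 + sigma_2) / 12). *)
Lemma K2_staircase a b c A B C E
    (P := (A * b)%N%:R : rat) (Q := (B * c)%N%:R : rat)
    (X := (C * b)%N%:R : rat) (Y := (E * c)%N%:R : rat) :
    (0 < a)%N -> (0 < b)%N -> gcdn (gcdn a b) c = 1%N ->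
    (C <= A)%N -> (E <= B)%N ->
    (forall x y, apery a b c x y
       = [&& (x < A)%N, (y < B)%N & (x < C)%N || (y < E)%N]) ->
  [/\ a%:R * b%:R * c%:R = P * Y + X * Q - X * Y
    & 60 * (a%:R * b%:R * c%:R) * K2 a b c
      = (X + Q) ^+ 5 + (P + Y) ^+ 5 - P ^+ 5 - Q ^+ 5 - (X + Y) ^+ 5].
Proof.
move=> a_gt0 b_gt0 gcd1 le_C le_E LE.
have main f := sum_gaps_staircase f a_gt0 b_gt0 gcd1 le_C le_E LE.
have [N gap_lt] := gaps_bounded a_gt0 b_gt0 gcd1.
split.
  have := main (fun n => n%:R ^+ 2); rewrite /= (sum_gaps_nat _ gap_lt).
  rewrite big1_seq; last by move=> s _; rewrite !natrD; ring.
  under eq_bigr => i _.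
    have -> : i%:R ^+ 2 - (i + b)%:R ^+ 2 - (i + c)%:R ^+ 2
           + (i + b + c)%:R ^+ 2
       = 2 * b%:R * c%:R :> rat by rewrite !natrD; ring.
    over.
  rewrite sumr_const_nat subn0 !natrD -/P -/Q -/X -/Y -mulr_natl => e.
  by lra.
pose G r := \sum_(0 <= s < N | `[< gaps a b c s >]) (s%:R : rat) ^+ r.
have GE r : gap_sum a b c r = G r by rewrite /gap_sum (sum_gaps_nat _ gap_lt).
have := main (fun n => n%:R ^+ 5).
rewrite /K2 !GE /= sum_quintic (sum_gaps_nat _ gap_lt).
set K0 := _ / 3; set kap := _ / 12.
have -> : \sum_(0 <= s < N | `[< gaps a b c s >])
   ((s%:R ^+ 5 - (s + b)%:R ^+ 5 - (s + c)%:R ^+ 5 + (s + b + c)%:R ^+ 5)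
    - ((s + a)%:R ^+ 5 - (s + a + b)%:R ^+ 5 - (s + a + c)%:R ^+ 5
       + (s + a + b + c)%:R ^+ 5))
   = - (60 * (a%:R * b%:R * c%:R))
     * (G 2 + sigma a b c 1 * G 1 + kap * G 0) :> rat.
  rewrite /G !mulr_sumr -!big_split /= mulr_sumr.
  apply: eq_bigr => s _; rewrite /kap /sigma !natrD.
  by move: (a%:R) (b%:R) (c%:R) (s%:R) => u v w t; field.
rewrite !natrD -/P -/Q -/X -/Y => e.
by lra.
Qed.

(** * The inequality *)

(** Put P = X + a, Q = Y + b.  The assumptions say that k = b - a and
    m = X - k are nonnegative, and X, P, Q are polynomials in Y, a, k, m.  In
    these variables 3 M - 10 V (X+Q)^3 and 20 V (X+Q)^3 - 3 M have nonnegative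
    coefficients; the terms 5 Y^4 (k + m) = 5 Y^4 X make them positive. *)
Lemma corner_bounds_le (R : realFieldType) (X Y P Q : R)
    (V := P * Y + X * Q - X * Y)
    (M := (X + Q) ^+ 5 + (P + Y) ^+ 5 - P ^+ 5 - Q ^+ 5 - (X + Y) ^+ 5) :
    0 < X -> 0 < Y -> X <= P -> Q - Y <= P -> P + Y <= X + Q ->
  10 * V * (X + Q) ^+ 3 < 3 * M < 20 * V * (X + Q) ^+ 3.
Proof.
move=> X_gt0 Y_gt0 X_le_P P_ge Q_ge.
pose a := P - X; pose k := (Q - Y) - a; pose m := X - k.
have a_ge0 : 0 <= a by rewrite subr_ge0.
have k_ge0 : 0 <= k by rewrite /k /a; lra.
have m_ge0 : 0 <= m by rewrite /m /k /a; lra.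
have X_def : X = k + m by rewrite /m; ring.
have P_def : P = k + m + a by rewrite -X_def /a; ring.
have Q_def : Q = Y + (a + k) by rewrite /k; ring.
have Y_ge0 := ltW Y_gt0.
have lead_gt0 : 0 < 5 * Y ^+ 4 * (k + m).
  by rewrite -X_def mulr_gt0 // mulr_gt0 // exprn_gt0.
clearbody a k m; clear X_le_P P_ge Q_ge X_gt0.
rewrite /M /V {M V} X_def P_def Q_def.
apply/andP; split; rewrite -subr_gt0.
  rewrite [X in 0 < X](_ : _ = 5 * Y ^+ 4 * (k + m) + 5 * (
    Y ^+ 4 * a + Y * a ^+ 4 + 4 * Y ^+ 3 * a * k + 4 * Y * a ^+ 3 * k +
    a ^+ 4 * k + 4 * Y ^+ 3 * k ^+ 2 + 6 * Y ^+ 2 * a * k ^+ 2 +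
    6 * Y * a ^+ 2 * k ^+ 2 + 4 * a ^+ 3 * k ^+ 2 + 6 * Y ^+ 2 * k ^+ 3 +
    8 * Y * a * k ^+ 3 + 6 * a ^+ 2 * k ^+ 3 + 5 * Y * k ^+ 4 + 5 * a * k ^+ 4
    + 2 * k ^+ 5 + 10 * Y ^+ 3 * a * m + 12 * Y ^+ 2 * a ^+ 2 * m +
    10 * Y * a ^+ 3 * m + a ^+ 4 * m + 4 * Y ^+ 3 * k * m +
    24 * Y ^+ 2 * a * k * m + 24 * Y * a ^+ 2 * k * m + 4 * a ^+ 3 * k * m +
    6 * Y ^+ 2 * k ^+ 2 * m + 24 * Y * a * k ^+ 2 * m +
    6 * a ^+ 2 * k ^+ 2 * m + 8 * Y * k ^+ 3 * m + 8 * a * k ^+ 3 * m +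
    5 * k ^+ 4 * m + 12 * Y ^+ 2 * a * m ^+ 2 + 12 * Y * a ^+ 2 * m ^+ 2 +
    24 * Y * a * k * m ^+ 2 + 6 * Y * k ^+ 2 * m ^+ 2 +
    6 * a * k ^+ 2 * m ^+ 2 + 6 * k ^+ 3 * m ^+ 2 + 10 * Y * a * m ^+ 3 +
    4 * Y * k * m ^+ 3 + 4 * a * k * m ^+ 3 + 4 * k ^+ 2 * m ^+ 3 + Y * m ^+ 4
    + a * m ^+ 4 + k * m ^+ 4)); last by ring.
  by rewrite ltr_wpDr // mulr_ge0 // !addr_ge0 // !mulr_ge0 // ?exprn_ge0.
rewrite [X in 0 < X](_ : _ = 5 * Y ^+ 4 * (k + m) + 5 * (
    Y ^+ 4 * a + 6 * Y ^+ 3 * a ^+ 2 + 6 * Y ^+ 2 * a ^+ 3 + Y * a ^+ 4 +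
    16 * Y ^+ 3 * a * k + 36 * Y ^+ 2 * a ^+ 2 * k + 16 * Y * a ^+ 3 * k +
    a ^+ 4 * k + 10 * Y ^+ 3 * k ^+ 2 + 60 * Y ^+ 2 * a * k ^+ 2 +
    60 * Y * a ^+ 2 * k ^+ 2 + 10 * a ^+ 3 * k ^+ 2 + 30 * Y ^+ 2 * k ^+ 3 +
    80 * Y * a * k ^+ 3 + 30 * a ^+ 2 * k ^+ 3 + 35 * Y * k ^+ 4 +
    35 * a * k ^+ 4 + 14 * k ^+ 5 + 4 * Y ^+ 3 * a * m +
    12 * Y ^+ 2 * a ^+ 2 * m + 4 * Y * a ^+ 3 * m + a ^+ 4 * m +
    16 * Y ^+ 3 * k * m + 60 * Y ^+ 2 * a * k * m + 60 * Y * a ^+ 2 * k * m +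
    16 * a ^+ 3 * k * m + 60 * Y ^+ 2 * k ^+ 2 * m + 132 * Y * a * k ^+ 2 * m
    + 60 * a ^+ 2 * k ^+ 2 * m + 80 * Y * k ^+ 3 * m + 80 * a * k ^+ 3 * m +
    35 * k ^+ 4 * m + 6 * Y ^+ 3 * m ^+ 2 + 12 * Y ^+ 2 * a * m ^+ 2 +
    12 * Y * a ^+ 2 * m ^+ 2 + 6 * a ^+ 3 * m ^+ 2 + 36 * Y ^+ 2 * k * m ^+ 2
    + 60 * Y * a * k * m ^+ 2 + 36 * a ^+ 2 * k * m ^+ 2 +
    60 * Y * k ^+ 2 * m ^+ 2 + 60 * a * k ^+ 2 * m ^+ 2 + 30 * k ^+ 3 * m ^+ 2
    + 6 * Y ^+ 2 * m ^+ 3 + 4 * Y * a * m ^+ 3 + 6 * a ^+ 2 * m ^+ 3 +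
    16 * Y * k * m ^+ 3 + 16 * a * k * m ^+ 3 + 10 * k ^+ 2 * m ^+ 3 +
    Y * m ^+ 4 + a * m ^+ 4 + k * m ^+ 4)); last by ring.
by rewrite ltr_wpDr // mulr_ge0 // !addr_ge0 // !mulr_ge0 // ?exprn_ge0.
Qed.

Lemma corner_bounds (R : realFieldType) (X Y P Q : R)
    (V := P * Y + X * Q - X * Y) (g := Num.max (X + Q) (P + Y))
    (M := (X + Q) ^+ 5 + (P + Y) ^+ 5 - P ^+ 5 - Q ^+ 5 - (X + Y) ^+ 5) :
    0 < X -> 0 < Y -> X <= P -> Y <= Q -> P - X <= Q -> Q - Y <= P ->
  10 * V * g ^+ 3 < 3 * M < 20 * V * g ^+ 3.
Proof.
move=> X_gt0 Y_gt0 X_le_P Y_le_Q P_le Q_le; rewrite /g.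
case: (leP (P + Y) (X + Q)) => [le_PY|/ltW le_XQ].
  exact: corner_bounds_le.
have := corner_bounds_le Y_gt0 X_gt0 Y_le_Q P_le.
rewrite [Q + X]addrC [Y + P]addrC => /(_ le_XQ).
have -> : Q * X + Y * P - Y * X = V by rewrite /V; ring.
have -> // : (P + Y) ^+ 5 + (X + Q) ^+ 5 - Q ^+ 5 - P ^+ 5 - (Y + X) ^+ 5 = M.
by rewrite /M; ring.
Qed.

(** The value x b + y c is largest over L at (C-1, B-1) or at (A-1, E-1); adding
    b + c moves these points to the outer corners of the staircase. *)
Lemma g3_staircase a b c A B C E :
    (1 < a)%N -> (1 < b)%N -> (1 < c)%N -> gcdn (gcdn a b) c = 1%N ->
    (0 < C <= A)%N -> (0 < E <= B)%N ->
    (forall x y, apery a b c x y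
       = [&& (x < A)%N, (y < B)%N & (x < C)%N || (y < E)%N]) ->
  g3 a b c
  = Num.max ((C * b)%N%:R + (B * c)%N%:R) ((A * b)%N%:R + (E * c)%N%:R).
Proof.
move=> a_gt1 b_gt1 c_gt1 gcd1 C_range E_range LE.
have gE x y : apery a b c x y ->
    (forall x' y', apery a b c x' y' -> (x' * b + y' * c <= x * b + y * c)%N) ->
  g3 a b c = (x.+1 * b)%N%:R + (y.+1 * c)%N%:R.
  move=> Lxy max_xy.
  have := frobenius_apery a_gt1 b_gt1 c_gt1 gcd1 Lxy max_xy.
  move/(congr1 (fun n => n%:R : rat)).
  by rewrite /g3 /sigma !mulSn !natrD !expr1; lra.
have Lxy_le x y : apery a b c x y ->
    (x * b + y * c <= C.-1 * b + B.-1 * c)%N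
    \/ (x * b + y * c <= A.-1 * b + E.-1 * c)%N.
  rewrite LE => /and3P[x_lt y_lt /orP[x_lt'|y_lt']]; [left|right];
  by apply: leq_add; rewrite leq_mul2r; apply/orP; right; lia.
have predE (n k : nat) : (0 < n)%N -> (n * k = k + n.-1 * k)%N.
  by case: n.
have [C_gt0 C_le] := andP C_range; have [E_gt0 E_le] := andP E_range.
case: leP; rewrite -!natrD => le_g.
  move: le_g; rewrite ler_nat => le_g.
  rewrite (gE A.-1 E.-1) ?prednK ?natrD //; try lia.
    by rewrite LE; lia.
  move=> x y /Lxy_le[le1|//]; apply: leq_trans le1 _.
  move: le_g; rewrite (predE C) ?(predE A) ?(predE B) ?(predE E); lia.
move: le_g; rewrite ltr_nat => le_g.
rewrite (gE C.-1 B.-1) ?prednK ?natrD //; try lia.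
  by rewrite LE; lia.
move=> x y /Lxy_le[//|le1]; apply: leq_trans le1 _.
move: le_g; rewrite (predE C) ?(predE A) ?(predE B) ?(predE E); lia.
Qed.

Theorem mainTheorem4 (d1 d2 d3 : nat)
  (d1_pos : (0 < d1)%N) (d2_pos : (0 < d2)%N) (d3_pos : (0 < d3)%N)
  (gcd_d : gcdn (gcdn d1 d2) d3 = 1%N)
  (d1_ge3 : (3 <= d1)%N) (d12 : (d1 < d2)%N) (d23 : (d2 < d3)%N)
  (d3_le : (d3 <= d1 * d2 - d1 - d2)%N)
  (d1_min : ~ semigroup2 d2 d3 d1)
  (d2_min : ~ semigroup2 d1 d3 d2)
  (d3_min : ~ semigroup2 d1 d2 d3) :
  1 / 18 < h2 d1 d2 d3 /\ h2 d1 d2 d3 < 1 / 9.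
Proof.
have d1_gt1 : (1 < d1)%N by apply: leq_trans d1_ge3.
have d2_gt1 := ltn_trans d1_gt1 d12; have d3_gt1 := ltn_trans d2_gt1 d23.
have [A [B [C [E [C_range E_range le_A le_B LE]]]]] :=
  apery_shape d1_pos d2_pos d3_pos gcd_d.
have [C_gt0 C_le] := andP C_range; have [E_gt0 E_le] := andP E_range.
have [volE K2E] := K2_staircase d1_pos d2_pos gcd_d C_le E_le LE.
have g3E := g3_staircase d1_gt1 d2_gt1 d3_gt1 gcd_d C_range E_range LE.
pose vol : rat := d1%:R * d2%:R * d3%:R.
have vol_gt0 : 0 < vol by rewrite !mulr_gt0 ?ltr0n.
have g_gt0 : 0 < g3 d1 d2 d3.
  by rewrite g3E lt_max -natrD ltr0n addn_gt0 muln_gt0 C_gt0 d2_pos.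
have bounds : 10 * vol * g3 d1 d2 d3 ^+ 3
    < 3 * (60 * vol * K2 d1 d2 d3) < 20 * vol * g3 d1 d2 d3 ^+ 3.
  rewrite K2E /vol volE g3E; apply: corner_bounds.
  - by rewrite ltr0n muln_gt0 C_gt0.
  - by rewrite ltr0n muln_gt0 E_gt0.
  - by rewrite ler_nat leq_mul2r C_le orbT.
  - by rewrite ler_nat leq_mul2r E_le orbT.
  - by rewrite lerBlDr -natrD ler_nat addnC -leq_subLR -mulnBl.
  - by rewrite lerBlDr -natrD ler_nat addnC -leq_subLR -mulnBl.
have g3_gt0 : 0 < g3 d1 d2 d3 ^+ 3 by rewrite exprn_gt0.
rewrite /h2; move/andP: bounds g3_gt0 vol_gt0.
move: (K2 _ _ _) (g3 _ _ _ ^+ 3) => K G [lo hi] G_gt0 vol_gt0.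
rewrite (ltr_pdivlMr _ _ G_gt0) (ltr_pdivrMr _ _ G_gt0).
by split; rewrite -(ltr_pM2l vol_gt0); lra.
Qed.
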